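(* Let $X$ be a mixing subshift of finite type and let $f : X \to X$ be a cellular automaton. Then the following are equivalent: (1) the codomain restriction $f : X \to f(X)$ is split epic in the category $K3$ of sofic shifts and block maps, i.e. there is a block map $g : f(X) \to X$ such that $f \circ g = \mathrm{id}_{f(X)}$; (2) $f$ is (Von Neumann) regular as an element of the monoid $\mathrm{End}(X)$.
   Context: For a finite alphabet $\Sigma$, the full shift $\Sigma^{\mathbb{Z}}$ carries the product topology and the shift map $\sigma(x)_i = x_{i+1}$. A subshift is a closed shift-invariant subset of a full shift. A subshift is of finite type (an SFT) if it is defined by a finite set of forbidden words, and sofic if it can be defined by a regular language of forbidden words. The language of a subshift is the set of words appearing in its configurations. A subshift $X$ is mixing if for all words $u,v$ in the language of $X$, for all large enough $n$ there is a word $w$ with $|w|=n$ such that $uwv$ is in the language of $X$. A block map between subshifts $X$ and $Y$ is a continuous shift-commuting function $X \to Y$. A cellular automaton on $X$ is a block map $X \to X$; these form a monoid $\mathrm{End}(X)$ under composition. The category $K3$ has sofic shifts as objects and block maps as morphisms. A morphism $f : X \to Y$ of a category is split epic if there is a morphism $g : Y \to X$ with $f \circ g = \mathrm{id}_Y$. An element $a$ of a semigroup $S$ is (Von Neumann) regular if there is $b \in S$ such that $aba = a$ and $bab = b$. *)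

(* Defs.v *)
From HB Require Import structures.
From mathcomp Require Import all_boot all_order all_algebra.
From mathcomp Require Import zify.
From mathcomp Require Import boolp classical_sets functions cardinality filter.
From mathcomp Require Import topology.

Set Implicit Arguments.
Unset Strict Implicit.
Unset Printing Implicit Defensive.

Import GRing.Theory.
Local Open Scope classical_set_scope.
Local Open Scope ring_scope.

Record category := Category {
  obj : Type;
  hom : obj -> obj -> Type;
  idm : forall X, hom X X;
  comp : forall X Y Z, hom Y Z -> hom X Y -> hom X Z;
  comp1m : forall X Y (f : hom X Y), comp (idm Y) f = f;
  compm1 : forall X Y (f : hom X Y), comp f (idm X) = f;
  compA : forall X Y Z T (f : hom Z T) (g : hom Y Z) (h : hom X Y),
    comp f (comp g h) = comp (comp f g) h }.
Arguments hom : clear implicits.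
Arguments idm : clear implicits.

Definition split_epic (C : category) (X Y : obj C) (f : hom C X Y) :=
  exists g : hom C Y X, comp f g = idm C Y.

Definition vn_regular (S : semigroupType) (a : S) :=
  exists b : S, (a * b * a = a)%g /\ (b * a * b = b)%g.

Section Words.
Variable A : finType.

Definition config := prod_topology (fun _ : int => discrete_topology A).

HB.instance Definition _ := Topological.on config.

Definition shift (x : config) : config := fun i => x (i + 1).

Definition factor (x : config) (i : int) (n : nat) : seq A :=
  [seq x (i + k%:Z) | k <- iota 0 n].

Definition appears (w : seq A) (x : config) :=
  exists i, factor x i (size w) = w.

Definition avoid (F : set (seq A)) : set config :=
  [set x | forall w, F w -> ~ appears w x].

(* Regularity as recognizability by a deterministic finite automaton. *)
Definition regular_language (L : set (seq A)) :=
  exists (Q : finType) (q0 : Q) (delta : Q -> A -> Q) (acc : {set Q}),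
    L = [set w | foldl delta q0 w \in acc].

End Words.

(* Shift-invariance is the equality of [points] with its image: over the
   integers, forward invariance of a closed set does not imply it. *)
Record subshift := Subshift {
  alphabet : finType;
  points :> set (config alphabet);
  subshift_closed : closed points;
  subshift_shift : @shift alphabet @` points = points }.
Arguments points : clear implicits.

Definition language (X : subshift) : set (seq (alphabet X)) :=
  [set w | exists2 x, points X x & appears w x].
Arguments language : clear implicits.

Definition is_sft (X : subshift) :=
  exists F : seq (seq (alphabet X)), points X = avoid [set` F].

Definition is_sofic (X : subshift) :=
  exists2 F : set (seq (alphabet X)), regular_language F & points X = avoid F.

Definition mixing (X : subshift) :=
  forall u v, language X u -> language X v ->
  exists N, forall n, (N <= n)%N ->
  exists2 w, size w = n & language X (u ++ w ++ v).

(* A point of [X] seen as a configuration. *)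
Definition conf (X : subshift) (x : X) : config (alphabet X) := \val x.

Lemma mem_points (X : subshift) (x : X) : points X (conf x).
Proof. exact/set_mem/valP. Qed.

Lemma shift_points (X : subshift) (x : X) : shift (conf x) \in points X.
Proof.
rewrite inE -[X in X _]subshift_shift; exists (conf x) => //; exact: mem_points.
Qed.

Definition sub_shift (X : subshift) (x : X) : X := SigSub (shift_points x).

Record blockmap (X Y : subshift) := Blockmap {
  blockmap_fun :> X -> Y;
  blockmap_cont : continuous blockmap_fun;
  blockmap_shift : forall x, blockmap_fun (sub_shift x) =
                             sub_shift (blockmap_fun x) }.

Lemma blockmap_eq (X Y : subshift) (f g : blockmap X Y) : f =1 g -> f = g.
Proof.
case: f g => [f cf sf] [g cg sg] /= /funext fg; move: cf sf; rewrite fg => cf sf.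
by rewrite (Prop_irrelevance cf cg) (Prop_irrelevance sf sg).
Qed.

Program Definition blockmap_id X : blockmap X X := @Blockmap X X id _ _.
Next Obligation. by move=> X x; exact: cvg_id. Qed.
Next Obligation. by []. Qed.

Program Definition blockmap_comp X Y Z (f : blockmap Y Z) (g : blockmap X Y) :
  blockmap X Z := @Blockmap X Z (f \o g) _ _.
Next Obligation.
move=> X Y Z f g x; apply: continuous_comp; exact: blockmap_cont.
Qed.
Next Obligation. by move=> X Y Z f g x /=; rewrite !blockmap_shift. Qed.

Lemma blockmap_comp1m X Y (f : blockmap X Y) :
  blockmap_comp (blockmap_id Y) f = f.
Proof. exact: blockmap_eq. Qed.

Lemma blockmap_compm1 X Y (f : blockmap X Y) :
  blockmap_comp f (blockmap_id X) = f.
Proof. exact: blockmap_eq. Qed.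

Lemma blockmap_compA X Y Z T (f : blockmap Z T) (g : blockmap Y Z)
    (h : blockmap X Y) :
  blockmap_comp f (blockmap_comp g h) = blockmap_comp (blockmap_comp f g) h.
Proof. exact: blockmap_eq. Qed.

(* An alias of [blockmap X X] carrying the monoid structure of composition. *)
Definition endo (X : subshift) := blockmap X X.

HB.instance Definition _ X := gen_eqMixin (endo X).
HB.instance Definition _ X := gen_choiceMixin (endo X).
HB.instance Definition _ X := isMonoid.Build (endo X)
  (@blockmap_compA X X X X) (@blockmap_comp1m X X) (@blockmap_compm1 X X).

Record sofic_shift := SoficShift {
  sofic_subshift :> subshift;
  soficP : is_sofic sofic_subshift }.

Definition K3 : category := @Category sofic_shift
  (fun X Y => blockmap X Y) (fun X => blockmap_id X)
  (fun X Y Z f g => blockmap_comp f g)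
  (fun X Y => @blockmap_comp1m X Y) (fun X Y => @blockmap_compm1 X Y)
  (fun X Y Z T => @blockmap_compA X Y Z T).

Section Cylinders.
Variable A : finType.
Implicit Types x y : config A.

Definition cylinder x (n : nat) : set (config A) :=
  [set y | forall i : int, (`|i| <= n)%N -> y i = x i].

Lemma nbhs_cylinder x n : nbhs x (cylinder x n).
Proof.
have Fx : Filter (nbhs x) by exact: nbhs_filter.
suff: \forall y \near x, forall k : 'I_(n.*2.+1),
    y (k%:Z - n%:Z) = x (k%:Z - n%:Z).
  apply: filterS => y yx i ltin.
  have ltk : (`|(i + n%:Z)%R| < n.*2.+1)%N by lia.
  by have := yx (Ordinal ltk) => /=; rewrite (_ : _%:Z - _ = i) //; lia.
apply: (@filter_forall _ 'I_(n.*2.+1)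
  (fun k y => y (k%:Z - n%:Z) = x (k%:Z - n%:Z)) _ Fx) => k.
exact: (@proj_continuous int (fun=> discrete_topology A) _ x _
  (discrete_set1 (x _ : discrete_topology A))).
Qed.

Lemma cylinder_nbhs x U : nbhs x U -> exists n, cylinder x n `<=` U.
Proof.
pose G : set_system (config A) := filter_from setT (cylinder x).
have FG : Filter G.
  apply: filter_from_filter; first by exists 0%N.
  move=> m n _ _; exists (maxn m n) => // y yx; split=> i ltin; apply: yx; lia.
suff cvGx : G --> x by move=> /cvGx[n _ sU]; exists n.
apply/cvg_sup => i V [_ [[W oW <-] Wx sWV]]; exists `|i|%N => // y yx.
by apply: sWV => /=; rewrite yx.
Qed.

Lemma config_compact : compact [set: config A].
Proof.
have -> : [set: config A] = [set x | forall i : int, [set: A] (x i)].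
  by apply/seteqP.
apply: (@tychonoff int (fun=> discrete_topology A) (fun=> setT)) => _.
by apply: finite_compact; exact: (@finite_finset A).
Qed.

Lemma config_hausdorff : hausdorff_space (config A).
Proof.
apply: hausdorff_product => _ a b ab.
have [c []] := ab _ _ (discrete_set1 (a : discrete_topology A))
  (discrete_set1 (b : discrete_topology A)).
by move=> /= -> ->.
Qed.

Lemma size_factor x i n : size (factor x i n) = n.
Proof. by rewrite size_map size_iota. Qed.

Lemma eq_factor x y i j n : factor x i n = factor y j n <->
  forall k, (k < n)%N -> x (i + k%:Z) = y (j + k%:Z).
Proof.
split=> [xy k ltkn|xy]; last first.
  by apply/eq_in_map => k; rewrite mem_iota => /andP[_] /xy.
have := congr1 (fun s => nth (x (i + k%:Z)) s k) xy.
by rewrite !(nth_map 0%N) ?size_iota // !nth_iota.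
Qed.

Lemma factorS x i n : factor x i n.+1 = rcons (factor x i n) (x (i + n%:Z)).
Proof. by rewrite /factor -[n.+1]addn1 iotaD map_cat cats1. Qed.

Lemma factor_shift x i n : factor (shift x) i n = factor x (i + 1) n.
Proof.
by apply/eq_factor => k _; rewrite /shift; congr (x _); lia.
Qed.
End Cylinders.

Lemma conf_inj X : injective (@conf X).
Proof. exact: val_inj. Qed.

Lemma conf_shift (X : subshift) (x : X) : conf (sub_shift x) = shift (conf x).
Proof. by []. Qed.

Section Subshift.
Variable X : subshift.
Implicit Types x : X.

Lemma sub_config (z : config (alphabet X)) : points X z ->
  exists x, conf x = z.
Proof. by move=> /mem_set Xz; exists (SigSub Xz). Qed.

Lemma sub_unshift x : exists y, sub_shift y = x.
Proof.
have := mem_points x; rewrite -{1}(subshift_shift X) => -[z Xz zx].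
have [y yz] := sub_config Xz; exists y.
by apply: conf_inj; rewrite conf_shift -zx -yz.
Qed.

(* Translates of a point by an arbitrary integer, in a form compatible with
   block maps. *)
Lemma translate (Y : subshift) (f : blockmap X Y) x (n : int) :
  exists y, (forall i, conf y i = conf x (i + n)) /\
            (forall i, conf (f y) i = conf (f x) (i + n)).
Proof.
elim/int_rect: n => [|n [y [yx fyx]]|n [y [yx fyx]]].
- by exists x; split=> i; rewrite addr0.
- exists (sub_shift y); split=> i.
    by rewrite conf_shift /shift yx; congr (conf x _); lia. 
  by rewrite blockmap_shift conf_shift /shift fyx; congr (conf (f x) _); lia.
- have [z zy] := sub_unshift y; exists z; split=> i.
    have := yx (i - 1); rewrite -zy conf_shift /shift subrK => ->.
    by congr (conf x _); lia.
  have := fyx (i - 1).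
  rewrite -zy blockmap_shift conf_shift /shift subrK => ->.
  by congr (conf (f x) _); lia.
Qed.

Lemma subshift_compact : compact [set: X].
Proof.
have cX : compact (points X).
  apply: (subclosed_compact _ (config_compact (A := _))) => //.
  exact: subshift_closed.
move=> F PF _; pose G := (@conf X) @ F.
have [|p [Xp clp]] := cX G (fmap_proper_filter _ PF).
  by rewrite /G /=; apply: filterS filterT => x _; exact: mem_points.
have [q qp] := sub_config Xp; exists q; split=> // U V FU [W [[O oO <-] Oq sOV]].
have GU : G (@conf X @` U) by apply: (@filterS _ F _ U _ _ FU) => x Ux; exists x.
have pO : nbhs p O by apply: open_nbhs_nbhs; split=> //; rewrite -qp.
have [_ [[x Ux <-] Ox]] := clp _ _ GU pO.
by exists x; split=> //; exact: sOV.
Qed.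

Lemma subshift_avoid : points X = avoid (~` language X).
Proof.
apply/seteqP; split=> [x Xx w nLw wx|x xL]; first by apply: nLw; exists x.
apply: (subshift_closed (s := X)) => U /cylinder_nbhs[n sU].
have : language X (factor x (- n%:Z) n.*2.+1).
  apply: contrapT => nL; apply: (xL _ nL).
  by exists (- n%:Z); rewrite size_factor.
move=> [z /sub_config[y <-] [i]]; rewrite size_factor => /eq_factor yx.
have [t [ty _]] := translate (blockmap_id X) y (i + n%:Z).
exists (conf t); split; first exact: mem_points.
apply: sU => j ltjn; rewrite ty.
have kE : `|(j + n%:Z)%R|%N%:Z = j + n%:Z by lia.
have := yx `|(j + n%:Z)%R|%N; rewrite kE.
rewrite (_ : i + (j + n%:Z) = j + (i + n%:Z)); last lia.
by rewrite (_ : - n%:Z + (j + n%:Z) = j); [apply; lia|lia].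
Qed.
End Subshift.

Section Image.
Variables (X Y : subshift) (f : blockmap X Y).

Definition image_points : set (config (alphabet Y)) :=
  range (fun x => conf (f x)).

Lemma image_closed : closed image_points.
Proof.
apply: compact_closed; first exact: config_hausdorff.
apply: continuous_compact; last exact: subshift_compact.
apply: continuous_subspaceT => x.
apply: (continuous_comp (f := f) (g := @conf Y)); first exact: blockmap_cont.
exact: (@initial_continuous _ _ (@set_val _ _)).
Qed.

Lemma image_shift : @shift _ @` image_points = image_points.
Proof.
apply/seteqP; split=> [_ [_ [x _ <-] <-]|_ [x _ <-]].
  by exists (sub_shift x) => //; rewrite blockmap_shift conf_shift.
have [y <-] := sub_unshift x; exists (conf (f y)); first by exists y.
by rewrite blockmap_shift conf_shift.
Qed.

Definition image_subshift : subshift := Subshift image_closed image_shift.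

Lemma corestrict_in x : conf (f x) \in points image_subshift.
Proof. by rewrite inE; exists x. Qed.

Definition corestrict_fun (x : X) : image_subshift := SigSub (corestrict_in x).

Lemma corestrict_cont : continuous corestrict_fun.
Proof.
move=> x V [_ [[O oO <-] Ox sOV]].
have : nbhs (conf (f x)) O by exact: open_nbhs_nbhs.
move=> /(initial_continuous (f := @set_val _ (points Y))) /blockmap_cont fO.
apply: (@filterS _ (nbhs x) _ (f @^-1` (@conf Y @^-1` O)) _ _ fO) => y Oy.
exact: (sOV (corestrict_fun y)).
Qed.

Lemma corestrict_shift x :
  corestrict_fun (sub_shift x) = sub_shift (corestrict_fun x).
Proof.
by apply: conf_inj; rewrite conf_shift /conf /= blockmap_shift.
Qed.

Definition corestrict : blockmap X image_subshift :=
  Blockmap corestrict_cont corestrict_shift.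

Lemma blockmap_radius : exists r : nat, forall (x y : X) (i : int),
  (forall j : int, (`|(j - i)%R| <= r)%N -> conf x j = conf y j) ->
  conf (f x) i = conf (f y) i.
Proof.
have /compact_near_coveringP nc := @subshift_compact X.
pose P (n : nat) (x : X) := forall y : X,
  cylinder (conf x) n (conf y) -> conf (f y) 0 = conf (f x) 0.
have [|r _ Pr] := nc nat \oo P _.
  move=> x _.
  have : nbhs x [set y | conf (f y) 0 = conf (f x) 0].
    have := nbhs_cylinder (conf (f x)) 0.
    move=> /(initial_continuous (f := @set_val _ (points Y))) /blockmap_cont fO.
    apply: (@filterS _ (nbhs x) _
      (f @^-1` (@conf Y @^-1` cylinder (conf (f x)) 0)) _ _ fO) => y yx.
    exact: yx.
  move=> [W [[O oO <-] Ox sOV]].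
  have /cylinder_nbhs[n sO] : nbhs (conf x) O by exact: open_nbhs_nbhs.
  have fE (y : X) : cylinder (conf x) n (conf y) -> conf (f y) 0 = conf (f x) 0.
    by move=> /sO Oy; exact: sOV.
  exists ([set y : X | cylinder (conf x) n (conf y)], [set m | (n <= m)%N]).
    split; last by exists n.
    exact: (@initial_continuous _ _ (@set_val _ _)) (nbhs_cylinder _ _).
  move=> [y m] [/= yx ltnm] z zy; rewrite (fE y) // fE // => i lti.
  by rewrite zy ?yx //; lia.
exists r => x y i xy.
have [x' [x'E fx']] := translate f x i; have [y' [y'E fy']] := translate f y i.
rewrite -[i]add0r -fx' -fy'; apply: (Pr r (leqnn r)) => // j ltj.
by rewrite x'E y'E xy //; lia.
Qed.
End Image.

(* Soficness of the image is witnessed by a deterministic automaton reading a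
   word of the image; its state is the set of windows of length [m] that a
   preimage can show around the right end of the word read so far. *)
Section SoficImage.
Variables (X Y : subshift) (sftX : is_sft X) (f : blockmap X Y).

Lemma sft_glue : exists m0 : nat, forall (m : nat) (x z : X) (p : int),
  (m0 <= m)%N ->
  (forall j, p <= j -> j < p + m%:Z -> conf x j = conf z j) ->
  exists y : X, (forall j, j < p + m%:Z -> conf y j = conf x j) /\
                (forall j, p <= j -> conf y j = conf z j).
Proof.
have [F XF] := sftX; exists (\max_(w <- F) size w) => m x z p lem xz.
pose y : config (alphabet X) := fun j => if j < p then conf x j else conf z j.
have yx j : j < p + m%:Z -> y j = conf x j.
  by rewrite /y; case: ifP => // ltjp ltj; rewrite xz //; lia.
have yz j : p <= j -> y j = conf z j by rewrite /y; case: ifP => //; lia.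
have [y' y'E] : exists y' : X, conf y' = y.
  apply: sub_config; rewrite XF => w Fw [i wE].
  have [lepi|ltip] : p <= i \/ i < p by case: (Order.TotalTheory.leP p i) => _; [left|right].
    have := mem_points z; rewrite XF => /(_ w Fw); apply; exists i.
    by rewrite -[RHS]wE; apply/eq_factor => k _; rewrite yz //; lia.
  have := mem_points x; rewrite XF => /(_ w Fw); apply; exists i.
  rewrite -[RHS]wE; apply/eq_factor => k ltk; rewrite yx //.
  have : (size w <= \max_(w <- F) size w)%N by exact: leq_bigmax_seq.
  lia.
by exists y'; rewrite y'E.
Qed.

Lemma image_sofic : is_sofic (image_subshift f).
Proof.
exists (~` language (image_subshift f)); last exact: subshift_avoid.
have [r fr] := blockmap_radius f; have [m0 glue] := sft_glue.
pose m := (r.*2 + m0)%N.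
pose tfac (x : X) i : m.-tuple (alphabet X) :=
  Tuple (introT eqP (size_factor (conf x) i m)).
pose R (w : seq (alphabet Y)) : {set m.-tuple (alphabet X)} :=
  [set t | `[< exists x : X,
    factor (conf (f x)) (- (size w)%:Z) (size w) = w /\
    tfac x (- r%:Z) = t >]]%SET.
pose delta (S : {set m.-tuple (alphabet X)}) (a : alphabet Y) :=
  [set t | `[< exists x : X, [/\ tfac x (- r%:Z - 1) \in S,
    conf (f x) (- 1) = a & tfac x (- r%:Z) = t] >]]%SET.
have RS w a : R (rcons w a) = delta (R w) a.
  apply/setP => t; rewrite !inE; apply/asboolP/asboolP.
    move=> [x []]; rewrite size_rcons factorS => /eqP.
    rewrite eqseq_rcons => /andP[/eqP wE /eqP aE] tE.
    exists x; split=> //; last by rewrite -aE; congr (conf _ _); lia.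
    have [x' [xE fxE]] := translate f x (- 1).
    rewrite inE; apply/asboolP; exists x'; split.
      rewrite -[RHS]wE; apply/eq_factor => k _; rewrite fxE.
      by congr (conf _ _); lia.
    by apply/val_inj/eq_factor => k _; rewrite xE; congr (conf _ _); lia.
  move=> [z []]; rewrite inE => /asboolP[x [wE /(congr1 val)/eq_factor xz]] aE tE.
  have [x' [xE fxE]] := translate f x 1.
  have [|j lej ltj|y [yx yz]] := glue m x' z (- r%:Z - 1).
  - by rewrite /m; lia.
  - have kE : `|(j + r%:Z + 1)%R|%N%:Z = j + r%:Z + 1 by lia.
    have := xz `|(j + r%:Z + 1)%R|%N; rewrite kE xE.
    rewrite (_ : - r%:Z + (j + r%:Z + 1) = j + 1); last lia.
    by rewrite (_ : - r%:Z - 1 + (j + r%:Z + 1) = j); [apply; lia|lia].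
  exists y; split; last first.
    by rewrite -tE; apply/val_inj/eq_factor => k _; rewrite yz //; lia.
  rewrite size_rcons factorS; congr rcons.
    rewrite -[RHS]wE; apply/eq_factor => k ltk.
    rewrite (fr y x') => [|j ltj]; last by rewrite yx // /m; lia.
    by rewrite fxE; congr (conf _ _); lia.
  rewrite -aE (_ : _ + _ = - 1); last lia.
  by apply: fr => j ltj; rewrite yz //; lia.
have foldR w : foldl delta (R [::]) w = R w.
  by elim/last_ind: w => // w a IHw; rewrite foldl_rcons IHw RS.
exists {set m.-tuple (alphabet X)}, (R [::]), delta, [set finset.set0]%SET.
apply/seteqP; split=> w /=; rewrite foldR inE.
  move=> nLw; apply/eqP/setP => t; rewrite !inE; apply/asboolP => -[x [wE _]].
  by apply: nLw; exists (conf (f x)); [exists x|exists (- (size w)%:Z)].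
move=> /eqP Rw0 [_ [x _ <-] [i]]; rewrite -[size _]/(@size (alphabet Y) w) => wE.
have [x' [_ fxE]] := translate f x (i + (@size (alphabet Y) w)%:Z).
have : tfac x' (- r%:Z) \in R w.
  rewrite inE; apply/asboolP; exists x'; split=> //.
  rewrite -[RHS]wE; apply/eq_factor => k _; rewrite fxE.
  by congr (conf _ _); lia.
by rewrite Rw0 inE.
Qed.
End SoficImage.

Lemma image_id X : points (image_subshift (blockmap_id X)) = points X.
Proof.
apply/seteqP; split=> [_ [x _ <-]|x /sub_config[y <-]]; first exact: mem_points.
by exists y.
Qed.

Lemma sft_sofic X : is_sft X -> is_sofic X.
Proof.
move=> /image_sofic/(_ (blockmap_id X))[F regF FE].
by exists F; rewrite // -FE image_id.
Qed.

(* The corestriction of [f] to its image is a morphism of [K3] only once both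
   ends are known to be sofic: [sft_sofic] and [image_sofic]. *)
Definition K3_sft (X : subshift) (sftX : is_sft X) : obj K3 :=
  SoficShift (sft_sofic sftX).

Definition K3_image (X Y : subshift) (sftX : is_sft X) (f : blockmap X Y) :
  obj K3 := SoficShift (image_sofic sftX f).

Definition codomain_restriction (X Y : subshift) (sftX : is_sft X)
  (f : blockmap X Y) : hom K3 (K3_sft sftX) (K3_image sftX f) := corestrict f.

(* Main.v *)
(* If [g] is a section of [f] on [f(X)] and [g] extends to a cellular automaton
   [b] of [X], then [f b f = f].  The extension needs no marker lemma because
   the identity is already defined on all of [X]: apply the local rule of [g]
   on the long stretches of [x] that look locally like [f(X)], copy [x]
   elsewhere, and at each change between the two insert a connecting word of a
   fixed length provided by mixing.  The changes are kept far apart, so every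
   window of bounded size meets at most one of them and is a word of [X]. *)

From mathcomp Require Import all_boot all_order all_algebra.
From mathcomp Require Import zify.
From mathcomp Require Import boolp classical_sets functions filter topology.
Require Import Defs.

Set Implicit Arguments.
Unset Strict Implicit.
Unset Printing Implicit Defensive.

Import GRing.Theory.
Local Open Scope classical_set_scope.
Local Open Scope ring_scope.

(** * Windows of a subshift of finite type and connecting words *)

Lemma factor_cat (A : finType) (x : config A) i m n :
  factor x i (m + n) = factor x i m ++ factor x (i + m%:Z) n.
Proof.
rewrite /factor iotaD map_cat add0n; congr cat.
rewrite -[in LHS](addn0 m) iotaDl -map_comp; apply: eq_map => k /=.
by congr (x _); lia.
Qed.

Lemma language_factor (X : subshift) (z : config (alphabet X)) i n p m :
  language X (factor z i n) -> i <= p -> p + m%:Z <= i + n%:Z ->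
  language X (factor z p m).
Proof.
move=> [x Xx [j]]; rewrite size_factor => /eq_factor xz leip lepi.
exists x => //; exists (j + (p - i)); rewrite size_factor.
apply/eq_factor => k ltkm; have := xz `|(p - i + k%:Z)%R|%N.
have -> : `|(p - i + k%:Z)%R|%N%:Z = p - i + k%:Z by lia.
rewrite (_ : j + (p - i + k%:Z) = j + (p - i) + k%:Z); last lia.
by rewrite (_ : i + (p - i + k%:Z) = p + k%:Z); [apply; lia|lia].
Qed.

(** Take [m] to be the greatest length of a forbidden word: a forbidden word in [z] would be a
    prefix of a window of length [m], hence occur in a point of [X]. *)
Lemma sft_window (X : subshift) : is_sft X ->
  exists m, forall z : config (alphabet X),
    (forall p, language X (factor z p m)) -> points X z.
Proof.
move=> [F XF]; exists (\max_(w <- F) size w) => z zL.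
rewrite XF => w Fw [i wE].
have lew : (size w <= \max_(w <- F) size w)%N by exact: leq_bigmax_seq.
have [] := @language_factor X z _ _ i (size w) (zL i); [by []|lia|].
by move=> x Xx; rewrite wE; move: Xx; rewrite XF => /(_ w Fw).
Qed.

(** There are finitely many pairs of words of length [m], so a length beyond all their mixing
    thresholds serves every pair. *)
Lemma mixing_uniform (X : subshift) m : mixing X ->
  exists2 N, (0 < N)%N & forall u v, size u = m -> size v = m ->
    language X u -> language X v ->
    exists w, size w = N /\ language X (u ++ w ++ v).
Proof.
move=> mixX.
have /choice[N NP] (uv : m.-tuple (alphabet X) * m.-tuple (alphabet X)) :
    exists N, language X uv.1 -> language X uv.2 ->
      forall n, (N <= n)%N ->
      exists2 w, size w = n & language X (uv.1 ++ w ++ uv.2).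
  have [[Lu Lv]|nL] := pselect (language X uv.1 /\ language X uv.2).
    by have [N NP] := mixX _ _ Lu Lv; exists N.
  by exists 0%N => Lu Lv; case: nL.
exists (\max_uv N uv).+1 => // u v /eqP su /eqP sv Lu Lv.
have leN := leqW (leq_bigmax (F := N) (Tuple su, Tuple sv)).
by have [w] := NP (Tuple su, Tuple sv) Lu Lv _ leN; exists w.
Qed.

(** * Splicing at well separated switches *)

(* A switch of [D] is a position [s] with [D (s - 1) != D s]; the [N] cells of
   [h] starting at a switch are replaced by a word joining both sides. *)
Definition splice (A : finType) m N (W : seq A -> seq A -> seq A)
    (D : int -> bool) (h : config A) : config A := fun i =>
  if [pick d : 'I_N | D (i - d%:Z - 1) != D (i - d%:Z)] is Some d then
    nth (h i) (W (factor h (i - d%:Z - m%:Z) m) (factor h (i - d%:Z + N%:Z) m)) d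
  else h i.

Lemma splice_out (A : finType) m N W D (h : config A) i :
  (forall s, D (s - 1) != D s -> s <= i -> i < s + N%:Z -> False) ->
  splice m N W D h i = h i.
Proof.
move=> nsw; rewrite /splice; case: pickP => // d swd.
by case: (nsw _ swd); have := ltn_ord d; lia.
Qed.

Lemma run_const (D : int -> bool) p n :
  (forall s, p < s -> s < p + n%:Z -> D (s - 1) = D s) ->
  forall k, (k < n)%N -> D (p + k%:Z) = D p.
Proof.
move=> nsw; elim=> [|k IHk] ltkn; first by rewrite addr0.
rewrite -IHk; last lia.
by rewrite -nsw; [congr D; lia|lia|lia].
Qed.

Section Splice.
Variables (X : subshift) (m N : nat).
Variable W : seq (alphabet X) -> seq (alphabet X) -> seq (alphabet X).
Variables (D : int -> bool) (h : config (alphabet X)).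
Hypothesis far : forall s t, D (s - 1) != D s -> D (t - 1) != D t ->
  s < t -> s + (N + m.*2)%:Z <= t.

(** By [far], the switch found by [pick] can only be [s]: two distinct switches at distance less
    than [N] from the same cell are excluded. *)
Lemma splice_in s d : D (s - 1) != D s -> (d < N)%N ->
  splice m N W D h (s + d%:Z) =
  nth (h (s + d%:Z)) (W (factor h (s - m%:Z) m) (factor h (s + N%:Z) m)) d.
Proof.
move=> sw ltdN; rewrite /splice; case: pickP => [e swe|/(_ (Ordinal ltdN))].
  have lte := ltn_ord e; have : s = s + d%:Z - e%:Z.
    have [lt|lt|//] := Order.TotalTheory.ltgtP s (s + d%:Z - e%:Z).
      have := far sw swe lt; lia.
    have := far swe sw lt; lia.
  by move=> sE; rewrite -sE; congr nth; lia.
by rewrite /= addrK sw.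
Qed.

Hypothesis WP : forall u v, size u = m -> size v = m ->
  language X u -> language X v ->
  size (W u v) = N /\ language X (u ++ W u v ++ v).
Hypothesis hL : forall p, (forall k, (k < m)%N -> D (p + k%:Z) = D p) ->
  language X (factor h p m).

(** The gap [N + m.*2] leaves the [m] cells on each side of the replaced block free of switches and
    of other replaced blocks. Both flanks are thus unmodified words of [X], exactly those that [W]
    joins. *)
Lemma splice_switch s : D (s - 1) != D s ->
  language X (factor (splice m N W D h) (s - m%:Z) (m + (N + m))).
Proof.
move=> sw.
have Lu : language X (factor h (s - m%:Z) m).
  apply: hL; apply: run_const => t lt1 lt2; apply/eqP/negP => /negP swt.
  by have := far swt sw; lia.
have Lv : language X (factor h (s + N%:Z) m).
  apply: hL; apply: run_const => t lt1 lt2; apply/eqP/negP => /negP swt.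
  by have := far sw swt; lia.
have [sW] := WP (size_factor _ _ _) (size_factor _ _ _) Lu Lv.
rewrite !factor_cat (_ : s - m%:Z + m%:Z = s); last lia.
congr (language X (_ ++ _ ++ _)).
- apply/eq_factor => k ltk; rewrite splice_out // => t swt le1 lt2.
  have [lt|lt|tE] := Order.TotalTheory.ltgtP s t; [lia| |lia].
  by have := far swt sw lt; lia.
- apply: (@eq_from_nth _ (h s)) => [|k]; rewrite sW ?size_factor // => ltk.
  rewrite (nth_map 0%N) ?size_iota // nth_iota // add0n splice_in //.
  by apply: set_nth_default; rewrite sW.
- apply/eq_factor => k ltk; rewrite splice_out // => t swt le1 lt2.
  have [lt|lt|tE] := Order.TotalTheory.ltgtP s t; [|lia|lia].
  by have := far sw swt lt; lia.
Qed.

Hypothesis N_gt0 : (0 < N)%N.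

(** A window meeting a replaced block lies inside the word of [splice_switch]; any other window is
    copied from [h], with [D] constant on it. *)
Lemma splice_language p : language X (factor (splice m N W D h) p m).
Proof.
have [[s [sw lt1 lt2]]|nsw] := pselect (exists s,
    [/\ D (s - 1) != D s, s < p + m%:Z & p < s + N%:Z]).
  by apply: language_factor (splice_switch sw) _ _; lia.
have {}nsw s : D (s - 1) != D s -> s < p + m%:Z -> p < s + N%:Z -> False.
  by move=> ? ? ?; apply: nsw; exists s.
rewrite (_ : factor _ _ _ = factor h p m).
  apply/hL/run_const => s lt1 lt2; apply/eqP/negP => /negP sw.
  by apply: (nsw s sw) => //; lia.
apply/eq_factor => k ltk; rewrite splice_out // => s sw le1 lt2.
by apply: (nsw s sw); lia.
Qed.
End Splice.

(** * Local rules and separation of switches *)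

(* Stated with two base points, locality covers both continuity and shift
   invariance. *)
Definition local (A : finType) (T : Type) (n : nat)
    (F : config A -> int -> T) :=
  forall (x y : config A) i j,
  (forall k : int, (`|k| <= n)%N -> x (i + k) = y (j + k)) -> F x i = F y j.

Lemma local_blockmap (X Y : subshift) n
    (F : config (alphabet X) -> config (alphabet Y)) :
  local n F -> (forall x, points X x -> points Y (F x)) ->
  exists b : blockmap X Y, forall x, conf (b x) = F (conf x).
Proof.
move=> locF XY.
pose b (x : X) : Y := SigSub (mem_set (XY _ (mem_points x))).
have bE x : conf (b x) = F (conf x) by [].
have cont_b : continuous b.
  move=> x V [_ [[O oO <-] Ox sOV]].
  have /cylinder_nbhs[q sO] : nbhs (conf (b x)) O by exact: open_nbhs_nbhs.
  have : nbhs x (@conf X @^-1` cylinder (conf x) (q + n)).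
    exact: (@initial_continuous _ _ (@set_val _ _)) (nbhs_cylinder _ _).
  apply: (@filterS _ (nbhs x)) => y yx; apply: sOV; apply: sO => i lei.
  by apply: locF => k lek; apply: yx; lia.
have shift_b x : b (sub_shift x) = sub_shift (b x).
  apply: conf_inj; rewrite conf_shift !bE; apply/funext => i.
  by apply: locF => k _; rewrite conf_shift /shift; congr (conf x _); lia.
by exists (Blockmap cont_b shift_b).
Qed.

(* Thickening the centres of long runs of [G] keeps the switches apart: two runs
   whose gap is short would merge. *)
Definition thicken (K : nat) (G : int -> bool) (i : int) : bool :=
  `[< exists c, (`|(c - i)%R| <= K)%N /\
      forall e, (`|(e - c)%R| <= K.*2)%N -> G e >].

Lemma thicken_far K G s t : thicken K G (s - 1) != thicken K G s ->
  thicken K G (t - 1) != thicken K G t -> s < t -> s + K%:Z <= t.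
Proof.
move=> sws swt ltst; rewrite Order.TotalTheory.leNgt; apply/negP => lttK.
case Ds: (thicken K G s).
  have Ds1 : thicken K G (s - 1) = false.
    by case: (thicken _ _ (s - 1)) sws; rewrite Ds.
  have /asboolP[c [lec cG]] := Ds.
  (* A centre within [K] of [s] but not of [s - 1] is [c = s + K], so [thicken] holds from [s] to
     [s + K - 1], leaving no switch at [t]. *)
  have cE : ~ (`|(c - (s - 1))%R| <= K)%N.
    by move=> lec1; move/asboolP: Ds1; apply; exists c.
  have Dt u : s <= u -> u < s + K%:Z -> thicken K G u.
    by move=> leu ltu; apply/asboolP; exists c; split=> //; lia.
  by move: swt; rewrite !Dt //; lia.
have /asboolP[c [lec cG]] : thicken K G (s - 1).
  by case: (thicken _ _ (s - 1)) sws; rewrite Ds.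
have nDs c' : (`|(c' - s)%R| <= K)%N ->
    ~ (forall e, (`|(e - c')%R| <= K.*2)%N -> G e).
  by move=> lec' c'G; move/asboolP: Ds; apply; exists c'.
have cE : ~ (`|(c - s)%R| <= K)%N by move=> /nDs; apply.
have [u [leu ltu /asboolP[d [led dG]]]] :
    exists u, [/\ s <= u, u < s + K%:Z & thicken K G u].
  case Dt: (thicken K G t); first by exists t; split=> //; lia.
  exists (t - 1); split; [lia|lia|].
  by case: (thicken _ _ (t - 1)) swt; rewrite Dt.
(* Here [c = s - 1 - K] and [s + K < d < s + K.*2]. Moving the centre to [c + 1] adds only the cell
   [s + K], which the run around [d] covers; then [thicken] would hold at [s]. *)
apply: (nDs (c + 1)) => [|e lee]; first lia.
have [lec1|ltc1] := leqP `|(e - c)%R| K.*2; first exact: cG.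
by apply: dG; lia.
Qed.

Lemma local_thicken A n K (G : config A -> int -> bool) :
  local n G -> local (n + K + K.*2) (fun x => thicken K (G x)).
Proof.
move=> locG.
suff imp (x y : config A) i j :
    (forall k : int, (`|k| <= n + K + K.*2)%N -> x (i + k) = y (j + k)) ->
    thicken K (G x) i -> thicken K (G y) j.
  by move=> x y i j xy; apply/idP/idP; apply: imp => // k /xy.
move=> xy /asboolP[c [lec cG]]; apply/asboolP; exists (c - i + j).
split=> [|e lee]; first lia.
rewrite -(locG x y (e - j + i)); first by apply: cG; lia.
move=> k lek; have := xy (e - j + k).
rewrite (_ : i + (e - j + k) = e - j + i + k); last lia.
by rewrite (_ : j + (e - j + k) = e + k); [apply; lia|lia].
Qed.

Lemma local_splice (A : finType) n m N (W : seq A -> seq A -> seq A)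
    (D : config A -> int -> bool) (h : config A -> config A) :
  local n D -> local n h ->
  local (n + N + m).+1 (fun x => splice m N W (D x) (h x)).
Proof.
move=> locD loch x y i j xy.
have DE (d : int) : (`|d| <= N.+1)%N -> D x (i - d) = D y (j - d).
  move=> led; apply: locD => k lek; rewrite -!addrA; apply: xy; lia.
have hE (d : int) : (`|d| <= N + m)%N -> h x (i + d) = h y (j + d).
  move=> led; apply: loch => k lek; rewrite -!addrA; apply: xy; lia.
have hE0 : h x i = h y j by have := hE 0; rewrite !addr0; exact.
have swE (d : 'I_N) : (D x (i - d%:Z - 1) != D x (i - d%:Z)) =
    (D y (j - d%:Z - 1) != D y (j - d%:Z)).
  have ltd := ltn_ord d; rewrite DE; last lia.
  by have := DE (d%:Z + 1); rewrite !opprD !addrA => ->; last lia.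
rewrite /splice (eq_pick swE); case: pickP => // d _; have ltd := ltn_ord d.
rewrite hE0; congr (nth _ (W _ _) _); apply/eq_factor => k ltk.
  by have := hE (- d%:Z - m%:Z + k%:Z); rewrite !addrA; apply; lia.
by have := hE (- d%:Z + N%:Z + k%:Z); rewrite !addrA; apply; lia.
Qed.

(** * Extending a block map from a subshift of [X] to all of [X] *)

Section Extension.
Variables (X : subshift) (P : set (config (alphabet X))) (clP : closed P).
Variable shP : @shift (alphabet X) @` P = P.
(** Built over the alphabet of [X], so that points of [X] and [Y] are configurations of one type. *)
Let Y := Subshift clP shP.
Variables (g : blockmap Y X) (r : nat).
Hypothesis gr : forall (x y : Y) (i : int),
  (forall j : int, (`|(j - i)%R| <= r)%N -> conf x j = conf y j) ->
  conf (g x) i = conf (g y) i.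

Definition visible (q : nat) (x : config (alphabet X)) (i : int) : bool :=
  `[< exists y : Y, forall k : int, (`|k| <= q)%N -> conf y k = x (i + k) >].

(** The local rule of [g], whose value is unique by [gr]; the default [x i] handles windows seen in
    no point of [Y] and is itself local. *)
Definition local_image (x : config (alphabet X)) (i : int) : alphabet X :=
  xget (x i) [set a | exists y : Y,
    (forall k : int, (`|k| <= r)%N -> conf y k = x (i + k)) /\
    conf (g y) 0 = a].

Lemma local_visible q : local q (visible q).
Proof.
move=> x y i j xy; apply/asboolP/asboolP => -[z zE]; exists z => k lek.
  by rewrite zE // xy.
by rewrite zE // xy.
Qed.

Lemma local_local_image : local r local_image.
Proof.
move=> x y i j xy; rewrite /local_image.
have -> : x i = y j by have := xy 0; rewrite !addr0; exact.
congr xget; apply/seteqP; split=> a [z [zE ga]]; exists z; split=> // k lek.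
  by rewrite zE // xy.
by rewrite zE // xy.
Qed.

Lemma local_imageE x i j (y : Y) :
  (forall k : int, (`|k| <= r)%N -> conf y (j + k) = x (i + k)) ->
  local_image x i = conf (g y) j.
Proof.
move=> yx; rewrite /local_image.
case: xgetP => [a _ [z [zE <-]]|/(_ (conf (g y) j)) []].
  have [y' [y'E gy']] := translate g y j.
  rewrite -[j in RHS]add0r -gy'; apply: gr => k; rewrite subr0 => lek.
  by rewrite zE // -yx // y'E addrC.
have [y' [y'E gy']] := translate g y j.
exists y'; split=> [k lek|]; first by rewrite y'E -yx // addrC.
by rewrite gy' add0r.
Qed.

Lemma extend_blockmap : is_sft X -> mixing X ->
  exists b : blockmap X X, forall (x : X) (y : Y), conf x = conf y -> b x = g y.
Proof.
move=> sftX mixX.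
have [m mP] := sft_window sftX.
have [N N_gt0 NP] := mixing_uniform m mixX.
pose W u v := xget [::] [set w | size w = N /\ language X (u ++ w ++ v)].
have WP u v : size u = m -> size v = m -> language X u -> language X v ->
    size (W u v) = N /\ language X (u ++ W u v ++ v).
  move=> su sv Lu Lv; rewrite /W; case: xgetP => [w _ //|nw].
  by have [w wP] := NP u v su sv Lu Lv; have := nw w.
(* The separation that [splice_language] requires, supplied by [thicken_far]. *)
pose K := (N + m.*2)%N.
(* Radius [r + m] lets a single point of [Y] determine [m] consecutive values of [local_image],
   which then form a word of a point of [g]'s image. *)
pose D x := thicken K (visible (r + m) x).
pose h x : config (alphabet X) :=
  fun i => if D x i then local_image x i else x i.
have locD : local (r + m + K + K.*2) D.
  exact/local_thicken/local_visible.
have loch : local (r + m + K + K.*2) h.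
  move=> x y i j xy; rewrite /h (locD x y i j xy) (@local_local_image x y i j).
    by have := xy 0; rewrite !addr0 => ->.
  by move=> k lek; apply: xy; lia.
have hL (x : X) p : (forall k, (k < m)%N ->
    D (conf x) (p + k%:Z) = D (conf x) p) ->
    language X (factor (h (conf x)) p m).
  case Dp: (D (conf x) p) => Dk.
    have /asboolP[c [lec cG]] := Dp.
    have /asboolP[y yx] : visible (r + m) (conf x) p by apply: cG; lia.
    exists (conf (g y)); first exact: mem_points.
    exists 0; rewrite size_factor; apply/eq_factor => k ltk.
    rewrite add0r /h Dk //; apply/esym/local_imageE => e lee.
    by rewrite yx ?addrA //; lia.
  exists (conf x); first exact: mem_points.
  exists p; rewrite size_factor; apply/eq_factor => k ltk.
  by rewrite /h Dk.
have [|b bE] := @local_blockmap X X _ _ 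
    (@local_splice _ _ m N W _ _ locD loch).
  move=> z /sub_config[x <-]; apply: mP => p.
  by apply: splice_language => //; [move=> s t; exact: thicken_far|exact: hL].
exists b => x y xy; apply: conf_inj; rewrite bE; apply/funext => i.
(* On a point of [Y] every cell is visible, so there is no switch and [b] computes [g]. *)
have Dx j : D (conf x) j.
  apply/asboolP; exists j; split=> [|e _]; first by rewrite subrr.
  have [y' [y'E _]] := translate g y e.
  by apply/asboolP; exists y' => k _; rewrite xy y'E addrC.
rewrite splice_out => [|s]; last by rewrite !Dx.
by rewrite /h Dx; apply: local_imageE => k _; rewrite xy.
Qed.
End Extension.

(** * Regularity and sections *)

Lemma vn_regularP (S : semigroupType) (a b : S) :
  (a * b * a = a)%g -> vn_regular a.
Proof.
move=> aba; exists (b * a * b)%g; split; first by rewrite !mulgA !aba.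
have baba : (b * a * b * a = b * a)%g by rewrite -[in RHS]aba !mulgA.
by rewrite !mulgA !baba.
Qed.

Theorem theorem2 (X : subshift) (sftX : is_sft X) (mixX : mixing X)
    (f : endo X) :
  split_epic (codomain_restriction sftX f) <-> vn_regular f.
Proof.
split=> [[g fg]|[b [fbf _]]].
  have [r gr] := blockmap_radius (g : blockmap (image_subshift f) X).
  have [b bP] := extend_blockmap gr sftX mixX.
  apply: (@vn_regularP _ f (b : endo X)); apply: blockmap_eq => x /=.
  (* [b] agrees with the section [g] at [f x], whence [f b f = f]. *)
  rewrite (bP _ (corestrict f x)) //; apply: conf_inj.
  exact: (congr1 (fun k : blockmap (image_subshift f) _ =>
    conf (k (corestrict f x))) fg).
(* Conversely, the section is [b] restricted along the inclusion [e] of the image into [X], a block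
   map of radius 0; on [y = f x] it works because [f b f = f]. *)
have emb_local : local 0 (fun x : config (alphabet X) => x).
  by move=> x y i j xy; have := xy 0; rewrite !addr0; exact.
have [|e eE] := @local_blockmap (image_subshift f) X 0 _ emb_local.
  by move=> _ [x _ <-]; exact: mem_points.
exists (blockmap_comp (b : blockmap X X) e); apply: blockmap_eq => y.
have [x _ xy] := mem_points y; apply: conf_inj; rewrite -[RHS]xy.
have -> : f x = (f * b * f)%g x by rewrite fbf.
have ey : e y = f x by apply: conf_inj; rewrite eE -xy.
by rewrite /conf /= ey.
Qed.
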